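(* Let $\mathcal{A}=\{a_0,\dots,a_{n+1}\}\subset\mathbb{Z}^n$ be a circuit, let $C\in\mathbb{R}^{n\times(n+2)}$ be a matrix of rank $n$ with columns $C_0,\dots,C_{n+1}$ such that $\mathbf{0}\in\mathbb{R}_{>0}C_0+\cdots+\mathbb{R}_{>0}C_{n+1}$, and let $\sigma$ be an ordering for $C$. Take $b_j=(-1)^j\det A(j)$ and let $\mu=(\mu_0,\dots,\mu_{k-1})$ be the sequence associated to the strict ordering $\bar\sigma$ induced by $\sigma$. Then $$1+\operatorname{sgnvar}(\mu)\le\operatorname{vol}_{\mathbb{Z}\mathcal{A}}(\mathcal{A}).$$
   Context: Notation: $[s]=\{0,1,\dots,s-1\}$. For a finite real sequence $c=(c_0,\dots,c_r)$, $\operatorname{sgnvar}(c)$ is the number of pairs $i<j$ with $c_ic_j<0$ and $c_\ell=0$ for all $i<\ell<j$. Let $\mathcal{A}=\{a_0,\dots,a_{n+1}\}\subset\mathbb{Z}^n$ be an ordered set of cardinality $n+2$ whose convex hull has dimension $n$, and let $A\in\mathbb{Z}^{(n+1)\times(n+2)}$ be the matrix with columns $(1,a_j)$, $j=0,\dots,n+1$. $A(j)$ is the square matrix obtained from $A$ by deleting the column indexed by $j$. $\mathcal{A}$ is a circuit if it is minimally affinely dependent, i.e. all $b_j=(-1)^j\det A(j)$ are nonzero; the vector $(b_0,\dots,b_{n+1})^\top$ spans $\ker A$. Normalized volume: $\operatorname{vol}_{\mathbb{Z}}(\mathcal{A})$ is $n!$ times the Euclidean volume of the convex hull of $\mathcal{A}$,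 and $\operatorname{vol}_{\mathbb{Z}\mathcal{A}}(\mathcal{A})=\operatorname{vol}_{\mathbb{Z}}(\mathcal{A})/I$, where $I$ is the index in $\mathbb{Z}^n$ of the affine sublattice $\mathbb{Z}\mathcal{A}$ generated by $\mathcal{A}$ (equivalently, the index of the subgroup generated by the differences $a_i-a_j$). Let $C$ have rank $n$ and satisfy $\mathbf{0}\in\mathbb{R}_{>0}C_0+\cdots+\mathbb{R}_{>0}C_{n+1}$ (columns indexed by $[n+2]$). Let $P\in\mathbb{R}^{(n+2)\times 2}$ be a matrix whose columns form a basis of $\ker C$, with rows $P_0,\dots,P_{n+1}\in\mathbb{R}^2$ (unique up to linear transformation). Define the equivalence relation on $[n+2]$ by $i\sim j\iff\det(P_i,P_j)=0$, and let $K_0,\dots,K_{k-1}$ be its equivalence classes. An ordering for $C$ is a permutation $\sigma$ of $[n+2]$ such that for some $\epsilon\in\{-1,1\}$, $\epsilon\det(P_{\sigma_i},P_{\sigma_j})\ge 0$ for all $i<j$. If $K\subset[n+2]$ is a set of representatives of the equivalence classes, the induced strict ordering is the bijection $\bar\sigma:[k]\to K$ listing the elements of $K$ in the order in which their classes occur in $\sigma$, so that $\epsilon\det(P_{\bar\sigma_i},P_{\bar\sigma_j})>0$ for $i<j$. Write $K_{\bar\sigma_\ell}$ for the class containing $\bar\sigma_\ell$. For $\ell\in[k]$ put $$L_\ell=K_{\bar\sigma_0}\cup\dots\cup K_{\bar\sigma_\ell},\qquad \mu_\ell=\sum_{j\in L_\ell}b_j.$$ *)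

(* Defs.v *)
From HB Require Import structures.
From mathcomp Require Import all_boot all_order all_algebra all_fingroup.
From mathcomp Require Import finmap.
From mathcomp Require Import all_classical all_reals all_analysis.

Set Implicit Arguments.
Unset Strict Implicit.
Unset Printing Implicit Defensive.

Import Order.TTheory GRing.Theory Num.Theory.
Local Open Scope classical_set_scope.
Local Open Scope ring_scope.

Definition sgnvar (T : realDomainType) (r : nat) (c : 'I_r -> T) : nat :=
  #|[set p : 'I_r * 'I_r | [&& (p.1 < p.2)%N, c p.1 * c p.2 < 0 &
      [forall l : 'I_r, (p.1 < l < p.2)%N ==> (c l == 0)]]]%SET|.

(* The points of R^n are column vectors; the matrix with columns (1, a_j). *)
Definition homog_mx (n : nat) (a : 'I_n.+2 -> 'cV[int]_n) :
    'M[int]_(n.+1, n.+2) :=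
  col_mx (const_mx 1 : 'rV_n.+2) (\matrix_(i < n, j < n.+2) a j i 0).

Definition circuit_coef (n : nat) (a : 'I_n.+2 -> 'cV[int]_n)
    (j : 'I_n.+2) : int :=
  (-1) ^+ j * \det (col' j (homog_mx a)).

Definition real_pts (R : realType) (n m : nat) (a : 'I_m -> 'cV[int]_n) :
    'I_m -> 'cV[R]_n :=
  fun j => map_mx intr (a j).

Definition affinely_dependent (R : realType) (n m : nat) (p : 'I_m -> 'cV[R]_n)
    (S : {set 'I_m}) : Prop :=
  exists w : 'I_m -> R,
    [/\ exists2 j, j \in S & w j != 0,
        \sum_(j in S) w j = 0 & \sum_(j in S) w j *: p j = 0].

Definition minimally_affinely_dependent (R : realType) (n m : nat)
    (p : 'I_m -> 'cV[R]_n) : Prop :=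
  affinely_dependent p [set: 'I_m]%SET /\
  forall S : {set 'I_m}, S \proper [set: 'I_m]%SET -> ~ affinely_dependent p S.

Definition conv_hull (R : realType) (n m : nat) (p : 'I_m -> 'cV[R]_n) :
    set 'cV[R]_n :=
  [set x | exists w : 'I_m -> R,
    [/\ forall j, 0 <= w j, \sum_j w j = 1 & x = \sum_j w j *: p j]].

(* The dimension of the convex hull of the p_j is that of its affine hull,
   whose direction is spanned by the p_j - p_0. *)
Definition conv_dim (R : realType) (n m : nat) (p : 'I_m.+1 -> 'cV[R]_n) : nat :=
  \rank (\matrix_(i < n, j < m.+1) (p j - p ord0) i 0).

Definition is_circuit (R : realType) (n : nat) (a : 'I_n.+2 -> 'cV[int]_n) :
    Prop :=
  [/\ injective a, conv_dim (real_pts R a) = n &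
      minimally_affinely_dependent (real_pts R a)].

(* Lebesgue measure on R^n, as the n-fold product of lebesgue_measure: the
   recursive step is that of product_measure1, which integrates the measure of
   the sections. *)
Fixpoint lebesgue_cV (R : realType) (n : nat) : set 'cV[R]_n -> \bar R :=
  match n return set 'cV[R]_n -> \bar R with
  | 0 => fun X => (\1_X (0 : 'cV[R]_0))%:E
  | p.+1 => fun X =>
      (\int[@lebesgue_measure R]_x
         lebesgue_cV [set v : 'cV[R]_p | X (col_mx (x%:M : 'cV[R]_1) v)])%E
  end.

Definition vol_Z (R : realType) (n : nat) (a : 'I_n.+2 -> 'cV[int]_n) : \bar R :=
  ((n`!%:R)%:E * lebesgue_cV (conv_hull (real_pts R a)))%E.

Definition diff_lattice (n m : nat) (a : 'I_m -> 'cV[int]_n) : set 'cV[int]_n :=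
  [set v | exists c : 'I_m -> 'I_m -> int,
    v = \sum_i \sum_j c i j *: (a i - a j)].

(* Number of cosets of L; the value is 0 when there are infinitely many, which
   does not occur for the lattice of a full-dimensional configuration. *)
Definition lattice_index (n : nat) (L : set 'cV[int]_n) : nat :=
  #|` fset_set [set X | exists v, X = [set v + w | w in L]]|.

Definition vol_ZA (R : realType) (n : nat) (a : 'I_n.+2 -> 'cV[int]_n) :
    \bar R :=
  (vol_Z R a * ((lattice_index (diff_lattice a))%:R^-1)%:E)%E.

Definition zero_in_pos_span (R : realType) (n m : nat) (C : 'M[R]_(n, m)) :
    Prop :=
  exists w : 'I_m -> R, (forall j, 0 < w j) /\ \sum_j w j *: col j C = 0.

(* The columns of P form a basis of ker C: after transposition, the rows of P^T
   are free and span the row kernel of C^T. *)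
Definition is_gale_dual (R : realType) (n m d : nat) (C : 'M[R]_(n, m))
    (P : 'M[R]_(m, d)) : bool :=
  row_free P^T && (P^T == kermx C^T)%MS.

Definition row_det (R : realType) (m : nat) (P : 'M[R]_(m, 2)) (i j : 'I_m) : R :=
  \det (col_mx (row i P) (row j P)).

Definition gale_classes (R : realType) (m : nat) (P : 'M[R]_(m, 2)) :
    {set {set 'I_m}} :=
  equivalence_partition (fun i j => row_det P i j == 0) [set: 'I_m]%SET.

Definition gale_class (R : realType) (m : nat) (P : 'M[R]_(m, 2)) (i : 'I_m) :
    {set 'I_m} :=
  finset.pblock (gale_classes P) i.

Definition is_ordering (R : realType) (m : nat) (P : 'M[R]_(m, 2))
    (sigma : 'S_m) : Prop :=
  exists2 eps : R, eps = -1 \/ eps = 1 &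
    forall i j : 'I_m, (i < j)%N -> 0 <= eps * row_det P (sigma i) (sigma j).

(* Order of first occurrence in the list sigma_0, sigma_1, ... *)
Definition occurs_before (m : nat) (sigma : 'S_m) (X Y : {set 'I_m}) : Prop :=
  exists2 i, sigma i \in X & forall j, sigma j \in Y -> (i < j)%N.

Definition induced_strict_ordering (R : realType) (m : nat) (P : 'M[R]_(m, 2))
    (sigma : 'S_m) (K : {set 'I_m})
    (sbar : 'I_#|gale_classes P| -> 'I_m) : Prop :=
  [/\ injective sbar, [set sbar l | l in 'I_#|gale_classes P|]%SET = K &
      forall l l' : 'I_#|gale_classes P|, (l < l')%N ->
        occurs_before sigma (gale_class P (sbar l)) (gale_class P (sbar l'))].

Definition initial_classes (R : realType) (m k : nat) (P : 'M[R]_(m, 2))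
    (sbar : 'I_k -> 'I_m) (l : 'I_k) : {set 'I_m} :=
  (\bigcup_(l' < k | (l' <= l)%N) gale_class P (sbar l'))%SET.

Definition mu (R : realType) (n k : nat) (a : 'I_n.+2 -> 'cV[int]_n)
    (P : 'M[R]_(n.+2, 2)) (sbar : 'I_k -> 'I_n.+2) (l : 'I_k) : int :=
  \sum_(j in initial_classes P sbar l) circuit_coef a j.

(* Main.v *)
Require Import Defs.
From mathcomp Require Import all_boot all_order all_algebra all_fingroup.
From mathcomp Require Import finmap zify lra.
From mathcomp Require Import all_classical all_reals all_analysis.
From mathcomp Require Import measurable_realfun.

(** Put b_j = [circuit_coef a j]; this vector lies in the kernel of the matrix
    with columns (1, a_j), so its entries sum to 0, and all of them are nonzero
    for a circuit. Let V be the sum of the positive b_j and g the index of the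
    difference lattice. The inequality splits into three facts.

    - g divides every b_j ([lattice_index_dvd]). In Smith coordinates the
      lattice spanned by the columns (1, a_j) is a product of lattices d_i Z, so
      its index is the product of the d_i, and this product divides every
      maximal minor. Subtracting multiples of (1, a_0) identifies the cosets of
      this lattice with the cosets of the difference lattice.

    - V is at most the normalized volume ([le_vol_Z]). The simplices
      conv(A minus a_j) with b_j > 0 have disjoint interiors, because the
      difference of two barycentric representations of one point is a multiple
      of b, and have normalized volumes b_j. Their contribution to the iterated
      Lebesgue integral is bounded from below by counting: the t-th dilate of
      the polytope contains at least V (t - c)^n / n! unit cubes with integer
      corners, hence the polytope itself contains as many cubes of side 1/t,
      and t tends to infinity. Inside one simplex the corners are r + sum_i k_i
      q_i, with r ranging over b_j coset representatives and k over the
      compositions of t with parts large enough to absorb r and the cube. The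
      passage from cubes to volume uses only that the integral is monotone.

    - (1 + sgnvar mu) g is at most V ([sgnvar_chain_bound]). The partial sums
      mu_l run over an increasing chain of index sets and are multiples of g. A
      sign variation moves the sum from one side of 0 to the other, so it costs
      at least 2 g of the total variation sum_j |b_j| = 2 V; starting from 0 and
      returning to 0 costs 2 g more. *)

Set Implicit Arguments.
Unset Strict Implicit.
Unset Printing Implicit Defensive.

Import Order.TTheory GRing.Theory Num.Theory.
Local Open Scope ring_scope.

(** * Cosets of an integer lattice *)

Definition in_lattice p m (H : 'M[int]_(p, m)) (v : 'cV[int]_p) : Prop :=
  exists u, v = H *m u.

(** The matrix E certifies that H has full row rank: were some d_i zero, the
    i-th row of the Smith form, and with it the determinant, would vanish. *)
Lemma smith_coordinates p m (H : 'M[int]_(p, m)) (E : 'M[int]_(m, p)) :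
  \det (H *m E) != 0 ->
  exists U : 'M[int]_p, exists d : 'I_p -> int,
    [/\ U \in unitmx, forall i, d i != 0 &
        forall v, in_lattice H v <-> forall i, (d i %| (U *m v) i ord0)%Z].
Proof.
move=> detHE.
have [L Lu [Q Qu [d _ defH]]] := int_Smith_normal_form H.
pose D : 'M[int]_(p, m) := \matrix_(i, j) (d`_i *+ (i == j :> nat)).
(* For p > m the rows of D below the m-th are zero whatever the list d says. *)
pose e (i : 'I_p) := if (i < m)%N then d`_i else 0.
have De i j : D i j = e i *+ (i == j :> nat).
  rewrite mxE /e; case: eqP => [->|_]; last by rewrite !mulr0n.
  by rewrite ltn_ord.
have e_neq0 i : e i != 0.
  apply: contraNneq detHE => ei0.
  rewrite defH -/D -!mulmxA det_mulmx (expand_det_row (_ *m _) i).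
  rewrite big1 ?mulr0// => j _; rewrite mxE big1 ?mul0r// => k _.
  by rewrite De ei0 mul0rn mul0r.
have lt_im (i : 'I_p) : (i < m)%N.
  by have := e_neq0 i; rewrite /e; case: ifP; rewrite ?eqxx.
exists (invmx L), e; split=> [||v] //; first by rewrite unitmx_inv.
split=> [[u ->] i|dv].
  rewrite defH -/D -!mulmxA mulKmx// mxE.
  apply: rpred_sum => j _; rewrite De.
  by case: eqP; rewrite ?mulr1n ?mulr0n ?mul0r ?dvdz0// => _; apply/dvdz_mulr.
pose u : 'cV[int]_m := \col_j \sum_(i < p | i == j :> nat)
  ((invmx L *m v) i ord0 %/ e i)%Z.
exists (invmx Q *m u).
rewrite defH -/D -!mulmxA mulKVmx// -[LHS](mulKVmx Lu).
congr (_ *m _); apply/matrixP=> i k; rewrite [k]ord1 [RHS]mxE.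
rewrite (bigD1 (Ordinal (lt_im i)))//= big1 => [|j neq_ji]; last first.
  rewrite De; case: eqP => [eq_ij|]; rewrite ?mulr0n ?mul0r//.
  by case/eqP: neq_ji; apply/val_inj.
rewrite addr0 De eqxx mulr1n [u _ _]mxE (big_pred1 i) //=.
rewrite [RHS]mulrC divzK// dv.
Qed.

(** In Smith coordinates the box of the residues 0 <= x_i < |d_i| meets every
    coset once. The last two clauses identify the index, the product of the
    |d_i|, with the least positive |det (H X)|, so that later arguments need not
    mention the d_i. *)
Lemma coset_representatives p m (H : 'M[int]_(p, m)) (E : 'M[int]_(m, p)) :
  \det (H *m E) != 0 ->
  exists s : seq 'cV[int]_p,
    [/\ uniq s, {in s &, forall v w, in_lattice H (v - w) -> v = w},
        forall v, exists2 w, w \in s & in_lattice H (v - w),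
        forall X, (size s %| \det (H *m X))%Z &
        exists X, `|(\det (H *m X))%R|%N = size s].
Proof.
move=> /smith_coordinates [U [d [Uu d_neq0 latP]]].
pose F := {dffun forall i : 'I_p, 'I_`|d i|}.
pose rep (f : F) : 'cV[int]_p := invmx U *m \col_i (f i : nat)%:Z.
have repK (f : F) i : (U *m rep f) i 0 = (f i : nat)%:Z.
  by rewrite mulKVmx// mxE.
have rep_inj f g : in_lattice H (rep f - rep g) -> f = g.
  move=> /latP fg; apply/ffunP => i; apply/val_inj => /=.
  have := fg i; rewrite mulmxBr mxE [X in _ + X]mxE !repK -eqz_mod_dvd.
  rewrite -(modz_abs (f i : nat)%:Z) -(modz_abs (g i : nat)%:Z).
  by rewrite !modz_small ?lez_nat ?ltz_nat //= => /eqP[].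
have lat0 : in_lattice H 0 by exists 0; rewrite mulmx0.
have sz : size [seq rep f | f : F] = `|(\prod_i d i)%R|%N.
  rewrite size_map -cardE card_dep_ffun.
  rewrite (big_morph _ abszM (erefl : `|1%Z|%N = 1%N)).
  rewrite -big_enum /image_mem.
  elim: (enum _) => [|i t IH]; first by rewrite big_nil.
  by rewrite big_cons /= card_ord IH.
have dvd_det X : (forall i j, (d i %| (U *m X) i j)%Z) ->
  (\prod_i d i %| \det X)%Z.
  move=> dX.
  pose Y : 'M[int]_p := \matrix_(i, j) ((U *m X) i j %/ d i)%Z.
  have -> : \det X = \det (invmx U) * ((\prod_i d i) * \det Y).
    rewrite -[X in LHS](mulKmx Uu) det_mulmx; congr (_ * _).
    have -> : U *m X = diag_mx (\row_i d i) *m Y.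
      apply/matrixP=> i j; rewrite mul_diag_mx [RHS]mxE [Y i j]mxE.
      by rewrite [(\row__ _) _ _]mxE mulrC divzK ?dX.
    rewrite det_mulmx det_diag; congr (_ * _).
    by apply: eq_bigr => i _; rewrite mxE.
  by apply/dvdz_mull/dvdz_mulr.
exists [seq rep f | f : F]; rewrite sz; split.
- rewrite map_inj_uniq ?enum_uniq// => f g fg.
  by apply: rep_inj; rewrite fg subrr.
- by move=> _ _ /mapP[f _ ->] /mapP[g _ ->] /rep_inj ->.
- move=> v.
  have modlt i : (`|((U *m v) i ord0 %% d i)%Z| < `|d i|)%N.
    rewrite -ltz_nat gez0_abs ?modz_ge0//; exact: ltz_mod.
  pose f : F := [ffun i => Ordinal (modlt i)].
  exists (rep f); first by apply/mapP; exists f; rewrite ?mem_enum.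
  apply/latP => i; rewrite mulmxBr mxE [X in _ + X]mxE repK ffunE/=.
  by rewrite gez0_abs ?modz_ge0// -eqz_mod_dvd modz_mod.
- move=> X; rewrite dvdzE /= -dvdzE; apply: dvd_det => i j.
  have /latP/(_ i) : in_lattice H (col j (H *m X)).
    by exists (col j X); rewrite !colE mulmxA.
  by rewrite colE mulmxA -colE mxE.
(* The vectors d_j U^-1 e_j form a basis of the lattice. *)
- have /fin_all_exists [X XP] j : exists u,
    invmx U *m (d j *: delta_mx j 0 : 'cV[int]_p) = H *m u.
    apply/latP => i; rewrite mulKVmx// !mxE.
    by case: eqP => [->|_]; rewrite ?mulr0 ?dvdz0// mulr1 dvdzz.
  exists (\matrix_(i, j) X j i 0).
  have -> : H *m \matrix_(i, j) X j i 0 = invmx U *m diag_mx (\row_i d i).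
    apply/matrixP => i j; have /matrixP/(_ i 0) := XP j.
    rewrite -scalemxAr mxE -colE mxE => XPij.
    rewrite mul_mx_diag [RHS]mxE [(\row__ _) _ _]mxE mulrC XPij.
    by rewrite !mxE; apply: eq_bigr => k _; rewrite mxE.
  rewrite det_mulmx det_diag abszM; under eq_bigr do rewrite mxE.
  have : \det (invmx U) \is a GRing.unit by rewrite -unitmxE unitmx_inv.
  by rewrite qualifE /= => /orP[] /eqP ->; rewrite mul1n.
Qed.

(** Working with the columns (1, q_j) instead of the differences q_i - q_j keeps
    all points on an equal footing and makes the minors the b_j themselves. *)
Definition affine_mx (T : pzRingType) n m (q : 'I_m -> 'cV[T]_n) :
    'M[T]_(1 + n, m) :=
  col_mx (const_mx 1) (\matrix_(i, j) q j i 0).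

Lemma affine_mx_mul (T : comPzRingType) n m (q : 'I_m -> 'cV[T]_n) (u : 'cV_m) :
  affine_mx q *m u = col_mx (\sum_j u j 0)%:M (\sum_j u j 0 *: q j).
Proof.
rewrite mul_col_mx; congr col_mx; apply/matrixP => i j.
  by rewrite !ord1 !mxE eqxx mulr1n; apply: eq_bigr => k _; rewrite mxE mul1r.
by rewrite ord1 mxE summxE; apply: eq_bigr => k _; rewrite !mxE mulrC.
Qed.

Lemma map_affine_mx (R : realType) n m (q : 'I_m -> 'cV[int]_n) :
  map_mx intr (affine_mx q) = affine_mx (real_pts R q).
Proof.
rewrite map_col_mx; congr col_mx; first by rewrite map_const_mx.
by apply/matrixP => i j; rewrite !mxE.
Qed.

Definition zero_sum_span n m (q : 'I_m -> 'cV[int]_n) (v : 'cV[int]_n) : Prop :=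
  exists2 u : 'cV[int]_m, \sum_j u j 0 = 0 & v = \sum_j u j 0 *: q j.

Lemma zero_sum_spanP n m (q : 'I_m -> 'cV[int]_n) v :
  zero_sum_span q v <-> in_lattice (affine_mx q) (col_mx 0 v).
Proof.
split=> [[u u0 ->]|[u]].
  exists u; rewrite affine_mx_mul u0; congr col_mx.
  by apply/matrixP => i j; rewrite !mxE mul0rn.
rewrite affine_mx_mul => /eq_col_mx[/matrixP/(_ 0 0)].
by rewrite !mxE eqxx mulr1n => u0 ->; exists u.
Qed.

(** Since the columns of [affine_mx q] have first coordinate 1, every coset of
    their lattice contains a vector (0, v), and v is determined modulo the
    zero-sum combinations of the q_j. *)
Lemma zero_sum_coset_representatives n m (q : 'I_m.+1 -> 'cV[int]_n) E :
  \det (affine_mx q *m E) != 0 ->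
  exists s : seq 'cV[int]_n,
    [/\ uniq s, {in s &, forall v w, zero_sum_span q (v - w) -> v = w},
        forall v, exists2 w, w \in s & zero_sum_span q (v - w),
        forall X, (size s %| \det (affine_mx q *m X))%Z &
        exists X, `|(\det (affine_mx q *m X))%R|%N = size s].
Proof.
move=> /coset_representatives[s [s_uniq s_inj s_onto s_dvd s_det]].
pose H := affine_mx q.
pose f (z : 'cV[int]_(1 + n)) := dsubmx z - z 0 0 *: q 0.
(* Subtracting a multiple of the column (1, q_0) clears the first coordinate
   without leaving the coset. *)
have f_lat z : in_lattice H (z - col_mx 0 (f z)).
  exists (z 0 0 *: delta_mx 0 0).
  have uE j : (z 0 0 *: delta_mx 0 0 : 'cV[int]_m.+1) j 0 = z 0 0 *+ (j == 0).
    by rewrite !mxE eqxx andbT mulr_natr.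
  rewrite affine_mx_mul.
  have -> : \sum_j (z 0 0 *: delta_mx 0 0 : 'cV[int]_m.+1) j 0 = z 0 0.
    rewrite (bigD1 0)//= uE big1 ?addr0 // => j /negPf j0.
    by rewrite uE j0.
  rewrite (bigD1 0)//= uE big1 ?addr0 => [|j /negPf j0]; last first.
    by rewrite uE j0 scale0r.
  rewrite -{1}(vsubmxK z) opp_col_mx add_col_mx opprB.
  rewrite (addrC (dsubmx z)) subrK oppr0 addr0.
  congr col_mx; apply/matrixP => i j; rewrite !ord1 !mxE eqxx mulr1n.
  by congr (z _ _); apply/val_inj.
have latD v w : in_lattice H v -> in_lattice H w -> in_lattice H (v + w).
  by move=> [x ->] [y ->]; exists (x + y); rewrite mulmxDr.
have latN v : in_lattice H v -> in_lattice H (- v).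
  by move=> [x ->]; exists (- x); rewrite mulmxN.
have f_cong v w : zero_sum_span q (f v - f w) -> in_lattice H (v - w).
  move=> /zero_sum_spanP fvw.
  have -> : v - w = (v - col_mx 0 (f v)) + col_mx 0 (f v - f w)
      - (w - col_mx 0 (f w)).
    have -> : col_mx 0 (f v - f w)
        = col_mx 0 (f v) - col_mx 0 (f w) :> 'cV_(1 + n).
      by rewrite opp_col_mx add_col_mx oppr0 addr0.
    by rewrite addrA subrK opprB addrA subrK.
  by apply/latD; [apply/latD|apply/latN].
exists (map f s); rewrite size_map; split=> //.
- rewrite map_inj_in_uniq // => v w vs ws fvw; apply: s_inj => //.
  apply: f_cong; rewrite fvw subrr.
  by exists 0; rewrite big1 // => j _; rewrite mxE ?scale0r.
- by move=> _ _ /mapP[v vs ->] /mapP[w ws ->] /f_cong/s_inj ->.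
- move=> v; have [w ws vw] := s_onto (col_mx 0 v).
  exists (f w); first exact: map_f.
  apply/zero_sum_spanP.
  have -> : col_mx 0 (v - f w) = (col_mx 0 v - w) + (w - col_mx 0 (f w)).
    by rewrite addrA subrK opp_col_mx add_col_mx oppr0 addr0.
  exact: latD.
Qed.

Lemma simplex_coset_representatives n (q : 'I_n.+1 -> 'cV[int]_n) :
  \det (affine_mx q) != 0 ->
  exists s : seq 'cV[int]_n,
    [/\ uniq s, {in s &, forall v w, zero_sum_span q (v - w) -> v = w} &
        size s = `|(\det (affine_mx q))%R|%N].
Proof.
move=> detq; have [|s [s_uniq s_inj _ s_dvd [X sX]]] :=
  @zero_sum_coset_representatives _ _ q 1%:M; first by rewrite mulmx1.
exists s; split=> //; apply/eqP; rewrite eqn_dvd; apply/andP; split.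
  by have := s_dvd 1%:M; rewrite mulmx1.
by rewrite -sX det_mulmx abszM dvdn_mulr.
Qed.

Lemma diff_latticeP n m (a : 'I_m.+1 -> 'cV[int]_n) v :
  diff_lattice a v <-> zero_sum_span a v.
Proof.
split=> [[c ->]|[u u0 ->]].
  exists (\col_i (\sum_j c i j - \sum_j c j i)).
    under eq_bigr do rewrite mxE.
    by rewrite sumrB exchange_big /= subrr.
  under [RHS]eq_bigr do rewrite mxE scalerBl !scaler_suml.
  rewrite sumrB [X in _ - X]exchange_big -sumrB; apply: eq_bigr => i _ /=.
  by rewrite -sumrB; apply: eq_bigr => j _; rewrite scalerBr.
exists (fun i j => if j == 0 then u i 0 else 0).
under [RHS]eq_bigr => i _.
  rewrite (bigD1 0) //= big1 ?addr0 => [|j /negPf->]; last by rewrite scale0r.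
  over.
under [RHS]eq_bigr do rewrite scalerBr.
by rewrite sumrB -scaler_suml u0 scale0r subr0.
Qed.

(** The representatives biject with the cosets, so the set of cosets is finite
    and its [fset_set] is not the default empty set. *)
Lemma lattice_index_dvd n m (a : 'I_m.+1 -> 'cV[int]_n) E :
  \det (affine_mx a *m E) != 0 ->
  (0 < lattice_index (diff_lattice a))%N /\
  forall X, (lattice_index (diff_lattice a) %| \det (affine_mx a *m X))%Z.
Proof.
move=> detE.
have [s [s_uniq s_inj s_onto s_dvd _]] := zero_sum_coset_representatives detE.
suff -> : lattice_index (diff_lattice a) = size s.
  split=> //; rewrite lt0n; apply: contraNneq detE => s0.
  by have := s_dvd E; rewrite s0 dvd0z.
pose coset (v : 'cV[int]_n) := [set v + w | w in diff_lattice a]%classic.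
have spanD v w :
    zero_sum_span a v -> zero_sum_span a w -> zero_sum_span a (v + w).
  move=> [x x0 ->] [y y0 ->]; exists (x + y).
    by under eq_bigr do rewrite mxE; rewrite big_split /= x0 y0 addr0.
  by rewrite -big_split; apply: eq_bigr => j _; rewrite mxE scalerDl.
have spanN v : zero_sum_span a v -> zero_sum_span a (- v).
  move=> [x x0 ->]; exists (- x).
    by under eq_bigr do rewrite mxE; rewrite sumrN x0 oppr0.
  by rewrite -sumrN; apply: eq_bigr => j _; rewrite mxE scaleNr.
have span0 : zero_sum_span a 0.
  by exists 0; rewrite big1 // => j _; rewrite mxE ?scale0r.
have coset_eq v w : coset v = coset w <-> zero_sum_span a (v - w).
  split=> [vw|vw].
    have : coset v v by exists 0; [apply/diff_latticeP | rewrite addr0].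
    by rewrite vw => -[x /diff_latticeP x0 <-]; rewrite addrC addKr.
  apply/seteqP; split=> _ [x /diff_latticeP x0 <-].
    exists (v - w + x); last by rewrite addrA addrCA subrr addr0.
    exact/diff_latticeP/spanD.
  exists (x - (v - w)); last by rewrite addrCA opprB subrKC addrC.
  exact/diff_latticeP/spanD/spanN.
have cosets_uniq : uniq (map coset s).
  by rewrite map_inj_in_uniq // => v w vs ws /coset_eq; apply: s_inj.
transitivity #|` [fset X in map coset s]%fset|; last first.
  by rewrite card_fseq undup_id // size_map.
rewrite -[in RHS](set_fsetK [fset X in map coset s]%fset).
congr (#|` fset_set _ |); apply/seteqP; split=> [_ [v ->]|X] /=.
  have [w ws /coset_eq vw] := s_onto v.
  by rewrite inE/=; apply/mapP; exists w.
by rewrite inE/= => /mapP[w _ ->]; exists w.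
Qed.

Lemma col'_colsub (T : pzSemiRingType) m n (M : 'M[T]_(m, n.+1)) j :
  col' j M = M *m colsub (lift j) 1%:M.
Proof. by rewrite mulmx_colsub mulmx1; apply/matrixP => i k; rewrite !mxE. Qed.

(** * Unit cubes in a dilated simplex *)

Lemma ffact_lower m n : (m ^ n <= (n + m) ^_ n)%N.
Proof.
elim: n => // n IH; rewrite addSn ffactSS expnS leq_mul //.
by rewrite -addSn leq_addl.
Qed.

(** Each p in s is r + sum_i k_i q_i with r a coset representative and k a
    composition of t all of whose parts are at least c1. The zero-sum
    coordinates of r + e, for e in the unit cube, are smaller than c1 in
    absolute value, so the coordinates of p + e stay positive. The shift c
    collects the mass spent on the lower bounds on the parts of k. *)
Lemma simplex_lattice_points (R : realType) n (q : 'I_n.+1 -> 'cV[int]_n) :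
  \det (affine_mx q) != 0 ->
  exists c, forall t, (c <= t)%N -> exists s : seq 'cV[int]_n,
  [/\ uniq s, (`|(\det (affine_mx q))%R| * (t - c) ^ n <= n`! * size s)%N &
    forall p, p \in s -> forall e : 'cV[R]_n, (forall i, 0 <= e i 0 <= 1) ->
      exists2 w : 'cV[R]_n.+1, forall i, 0 < w i 0 &
        affine_mx (real_pts R q) *m w = col_mx t%:R%:M (map_mx intr p + e)].
Proof.
move=> detq.
have [s0 [s0_uniq s0_inj s0_size]] := simplex_coset_representatives detq.
pose D := affine_mx (real_pts R q).
have Du : D \in unitmx.
  by rewrite unitmxE /D -map_affine_mx det_map_mx unitfE intr_eq0.
pose B : R := 1 + \sum_(r <- s0) \sum_i `|(r i 0)%:~R|.
have B_ge r (e : 'cV[R]_n) i : r \in s0 -> (forall i, 0 <= e i 0 <= 1) ->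
    `|(col_mx 0 (map_mx intr r + e) : 'cV[R]_(1 + n)) i 0| <= B.
  move=> rs e01; rewrite -[i]splitK; case: fintype.split => k /=.
    rewrite col_mxEu mxE normr0 addr_ge0 ?sumr_ge0// => r' _.
    by rewrite sumr_ge0.
  rewrite col_mxEd !mxE addrC (le_trans (ler_normD _ _)) // lerD //.
    by have /andP[e0 e1] := e01 k; rewrite ger0_norm.
  rewrite (big_rem r)//= (bigD1 k)//= -addrA lerDl addr_ge0 ?sumr_ge0//.
  by move=> r' _; rewrite sumr_ge0.
pose N := \sum_i \sum_l `|invmx D i l| * B.
have B_ge0 : 0 <= B by rewrite addr_ge0 ?sumr_ge0// => r _; rewrite sumr_ge0.
pose c1 := (Num.truncn N).+1.
have Nc1 : N < c1%:R by exact: truncnS_gt.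
have small r (e : 'cV[R]_n) i : r \in s0 -> (forall i, 0 <= e i 0 <= 1) ->
    `|(invmx D *m col_mx 0 (map_mx intr r + e)) i 0| < c1%:R.
  move=> rs e01; apply: le_lt_trans Nc1.
  rewrite mxE (le_trans (ler_norm_sum _ _ _))//.
  rewrite [leRHS](bigD1 i)//= -[leLHS]addr0 lerD//.
    by apply: ler_sum => l _; rewrite normrM ler_wpM2l// B_ge.
  by apply: sumr_ge0 => i' _; apply: sumr_ge0 => l _; rewrite mulr_ge0.
exists (n.+1 * c1)%N => t le_ct.
set T := (t - _)%N.
pose Y := [set y : n.+1.-tuple 'I_T.+1 | \sum_(i <- y) i == T]%N.
pose wt (y : n.+1.-tuple 'I_T.+1) : 'cV[int]_n.+1 := \col_i (c1 + tnth y i)%:Z.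
have wt_sum y : y \in Y -> \sum_i wt y i 0 = t%:Z.
  rewrite inE big_tuple => /eqP yT.
  under eq_bigr do rewrite mxE.
  rewrite -(big_morph Posz PoszD erefl) big_split /= sum_nat_const card_ord yT.
  by rewrite subnKC.
pose f r y := r + \sum_i wt y i 0 *: q i.
have f_inj r y r' y' : r \in s0 -> r' \in s0 -> y \in Y -> y' \in Y ->
    f r y = f r' y' -> (r, y) = (r', y').
  move=> rs rs' yY yY' fE.
  have subE j : (wt y' - wt y) j 0 = wt y' j 0 - wt y j 0.
    by rewrite [LHS]mxE [X in _ + X]mxE.
  have sum0 : \sum_j (wt y' - wt y) j 0 = 0.
    by under eq_bigr do rewrite subE; rewrite sumrB !wt_sum// subrr.
  have rB : r - r' = \sum_j (wt y' - wt y) j 0 *: q j.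
    under eq_bigr do rewrite subE scalerBl.
    rewrite sumrB; apply/eqP; rewrite subr_eq addrAC eq_sym subr_eq.
    by rewrite [X in X == _]addrC; apply/eqP/esym.
  have rr' : r = r' by apply: s0_inj => //; exists (wt y' - wt y).
  have ker0 : affine_mx q *m (wt y' - wt y) = 0.
    rewrite affine_mx_mul sum0 -rB rr' subrr raddf0.
    exact: col_mx0.
  have : \det (affine_mx q) *: (wt y' - wt y) = 0.
    by rewrite -mul_scalar_mx -mul_adj_mx -mulmxA ker0 mulmx0.
  move=> /matrixP adj0; rewrite rr'; congr (_, _).
  apply: eq_from_tnth => i; apply/val_inj.
  have /eqP := adj0 i 0; rewrite mxE [X in _ == X]mxE mulf_eq0 (negPf detq).
  by rewrite subE subr_eq0 !mxE eqz_nat eqn_add2l eq_sym => /eqP.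
exists [seq f r y | r <- s0, y <- enum Y]; split.
- apply: allpairs_uniq => //; first exact: enum_uniq.
  move=> z z' /allpairsP[[r y] [/= rs yY ->{z}]].
  move=> /allpairsP[[r' y'] [/= rs' yY' ->{z'}]].
  by rewrite /=; apply: f_inj => //; rewrite -mem_enum.
- rewrite size_allpairs s0_size -cardE card_ord_partitions mulnCA leq_mul2l.
  by rewrite mulnC bin_ffact ffact_lower orbT.
- move=> _ /allpairsP[[r y] [/= rs yY ->]] e e01.
  rewrite mem_enum in yY.
  exists (map_mx intr (wt y) + invmx D *m col_mx 0 (map_mx intr r + e)).
    move=> i; have := small r e i rs e01; rewrite ltr_norml => /andP[+ _].
    rewrite [(map_mx _ _ + _) i 0]mxE [map_mx _ _ i 0]mxE [wt y i 0]mxE.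
    rewrite -ltrBlDl sub0r; apply: le_lt_trans.
    by rewrite lerN2 -pmulrn ler_nat leq_addr.
  rewrite mulmxDr mulKVmx// -map_affine_mx -map_mxM affine_mx_mul wt_sum//.
  rewrite map_col_mx map_scalar_mx add_col_mx addr0; congr col_mx.
  by rewrite map_mxD addrA [in RHS](addrC (map_mx _ r)).
Qed.

(** * Volume from below by cubes *)

(** The integral of a nonnegative function is a supremum over the simple
    functions below it, so it is monotone even where measurability fails. This
    spares a proof that the sections of a polytope have measurable volume. *)
Lemma ge0_le_integralT d (T : measurableType d) (R : realType)
    (m : {measure set T -> \bar R}) (f g : T -> \bar R) :
  (forall x, 0 <= f x)%E -> (forall x, f x <= g x)%E ->
  (\int[m]_x f x <= \int[m]_x g x)%E.
Proof.
move=> f0 fg; rewrite !ge0_integralTE// => [|x]; last exact: le_trans (fg x).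
apply: le_ereal_sup => _ [h hf <-]; exists h => // x.
exact: le_trans (fg x).
Qed.

Lemma lebesgue_cV_ge0 (R : realType) n (X : set 'cV[R]_n) :
  (0 <= lebesgue_cV X)%E.
Proof.
elim: n X => [|n IH] X /=; first by rewrite lee_fin indicE.
by apply: integral_ge0 => x _; apply: IH.
Qed.

Lemma sum_count_undup (T : eqType) (s : seq T) :
  (\sum_(k <- undup s) count_mem k s = size s)%N.
Proof.
under eq_bigr do rewrite -sum1_count big_mkcond /=.
rewrite exchange_big /= -sum1_size big_seq [RHS]big_seq; apply: eq_bigr => x xs.
rewrite -big_mkcond sum1_count /=.
transitivity (count_mem x (undup s)).
  by apply: eq_count => k; rewrite /= eq_sym.
by rewrite count_uniq_mem ?undup_uniq // mem_undup xs.
Qed.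

(** By induction on n: over the interval I_k of abscissae, the section contains
    the cubes at the tails of the corners with first coordinate k, so the volume
    of the section dominates a step function whose integral counts all the
    cubes. *)
Lemma lebesgue_cV_cubes (R : realType) n (X : set 'cV[R]_n) (eps : R)
    (s : seq 'cV[int]_n) :
  0 < eps -> uniq s ->
  (forall p, p \in s -> forall e : 'cV[R]_n, (forall i, 0 <= e i 0 < 1) ->
     X (eps *: (map_mx intr p + e))) ->
  (((size s)%:R * eps ^+ n)%:E <= lebesgue_cV X)%E.
Proof.
move=> eps0; elim: n X s => [|n IH] X s s_uniq sX.
  rewrite /= expr0 mulr1 lee_fin.
  case: s s_uniq sX => [|p [|p' s]]; first by rewrite /= indicE.
    move=> _ /(_ p (mem_head _ _) 0); rewrite [_ *: _]flatmx0 => X0.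
    by rewrite /= indicE mem_set//; apply: X0 => -[].
  by rewrite (flatmx0 p) (flatmx0 p') /= inE eqxx.
pose hd (p : 'cV[int]_n.+1) := p 0 0.
pose tl (p : 'cV[int]_n.+1) : 'cV[int]_n := dsubmx (p : 'cV_(1 + n)).
pose N k := [seq tl p | p <- s & hd p == k].
have hdtl p p' : hd p = hd p' -> tl p = tl p' -> p = p'.
  move=> hpp' tpp'.
  have upp' : usubmx (p : 'cV_(1 + n)) = usubmx (p' : 'cV_(1 + n)).
    apply/matrixP => i j; rewrite !ord1 !mxE.
    by rewrite (_ : lshift n ord0 = ord0 :> 'I_(1 + n)) //; apply/val_inj.
  by rewrite -[p](@vsubmxK _ 1 n) -[p'](@vsubmxK _ 1 n) upp' -/(tl p) tpp'.
have N_uniq k : uniq (N k).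
  rewrite map_inj_in_uniq ?filter_uniq// => p p'.
  rewrite !mem_filter => /andP[/eqP hp _] /andP[/eqP hp' _].
  by apply: hdtl; rewrite hp hp'.
pose I (k : int) : set R := `[eps * k%:~R, eps * (k + 1)%:~R[%classic.
pose sec x :=
  lebesgue_cV [set v : 'cV[R]_n | X (col_mx (x%:M : 'cV[R]_1) v)]%classic.
have sec_ge x k : I k x -> (((size (N k))%:R * eps ^+ n)%:E <= sec x)%E.
  rewrite /I /= in_itv /= => /andP[kx xk].
  apply: IH => // _ /mapP[p + ->] e e01.
  rewrite mem_filter => /andP[/eqP hp ps] /=.
  pose e' : 'cV[R]_(1 + n) := col_mx (x / eps - k%:~R)%:M e.
  have -> : col_mx x%:M (eps *: (map_mx intr (tl p) + e))
      = eps *: (map_mx intr (p : 'cV[int]_(1 + n)) + e').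
    rewrite -[p in RHS](@vsubmxK _ 1 n) map_col_mx add_col_mx scale_col_mx.
    congr col_mx; apply/matrixP => i j; rewrite !ord1 !mxE eqxx !mulr1n.
    rewrite (_ : lshift n ord0 = ord0 :> 'I_(1 + n)); last exact/val_inj.
    by rewrite -hp addrC subrK mulrC divfK// gt_eqF.
  apply: sX => //; suff : forall i : 'I_(1 + n), 0 <= e' i 0 < 1 by [].
  move=> i; rewrite /e' -[i]splitK; case: fintype.split => j /=.
    rewrite col_mxEu ord1 mxE eqxx mulr1n subr_ge0 ler_pdivlMr// mulrC kx /=.
    by rewrite ltrBlDl ltr_pdivrMr// mulrC -intrD1.
  by rewrite col_mxEd.
pose Z := undup (map hd s).
have IZ k k' x : I k x -> I k' x -> k = k'.
  have fl j : I j x -> j = Num.floor (x / eps).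
    rewrite /I /= in_itv /= => /andP[jx xj]; apply/esym/floor_def.
    by rewrite ler_pdivlMr// ltr_pdivrMr// mulrC jx mulrC.
  by move=> /fl -> /fl ->.
pose g x := (\sum_(k <- Z) ((size (N k))%:R * eps ^+ n)%:E * (\1_(I k) x)%:E)%E.
have w0 k : 0 <= (size (N k))%:R * eps ^+ n.
  by rewrite mulr_ge0 // exprn_ge0 // ltW.
have g0 x : (0 <= g x)%E.
  by apply: sume_ge0 => k _; rewrite mule_ge0 // lee_fin // indicE.
have -> : ((size s)%:R * eps ^+ n.+1)%:E = (\int[@lebesgue_measure R]_x g x)%E.
  rewrite ge0_integral_sum //; first last.
  - by move=> k x _; rewrite mule_ge0 // lee_fin // indicE.
  - move=> k; apply: measurable_funeM; apply/measurable_EFinP.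
    apply: measurable_indic; exact: measurable_itv.
  under eq_bigr => k _.
    rewrite ge0_integralZl_EFin//; last first.
      by apply/measurable_EFinP; apply: measurable_indic; exact: measurable_itv.
    rewrite integral_indic//; last exact: measurable_itv.
    rewrite setIT /I /= lebesgue_measure_itv /= lte_fin.
    rewrite ltr_pM2l// ltr_int ltrDl ltr01 -EFinB -mulrBr intrD1 addrC addKr.
    rewrite mulr1 -EFinM -mulrA -exprSr size_map size_filter.
    over.
  rewrite /= sumEFin -mulr_suml -natr_sum; congr ((_ * _)%:E); congr _%:R.
  rewrite -(size_map hd) -sum_count_undup; apply: eq_bigr => k _.
  by rewrite count_map; apply: eq_count => p; rewrite /= eq_sym.
apply: ge0_le_integralT => // x.
have [[k kZ Ikx]|noI] := pselect (exists2 k, k \in Z & I k x).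
  rewrite /g (bigD1_seq k) ?undup_uniq //= big1_seq ?adde0.
    by rewrite indicE mem_set // mule1; exact: sec_ge.
  move=> k' /andP[k'k _]; rewrite indicE memNset ?mule0 // => Ik'x.
  by rewrite (IZ _ _ _ Ik'x Ikx) eqxx in k'k.
rewrite /g big1_seq ?lebesgue_cV_ge0 // => k /= kZ.
by rewrite indicE memNset ?mule0 // => Ikx; apply: noI; exists k.
Qed.

(** * The coefficients of a circuit and its triangulation *)

Lemma circuit_coef_kernel n (a : 'I_n.+2 -> 'cV[int]_n) :
  affine_mx a *m \col_j circuit_coef a j = 0.
Proof.
apply/matrixP => i k; rewrite ord1 [RHS]mxE mxE.
(* Doubling row i gives a square matrix with two equal rows, whose expansion
   along the added row is the entry to be computed. *)
pose M : 'M[int]_n.+2 :=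
  \matrix_(r, s) homog_mx a (if unlift 0 r is Some r' then r' else i) s.
have M0 s : M 0 s = homog_mx a i s by rewrite mxE unlift_none.
have MS r s : M (lift 0 r) s = homog_mx a r s by rewrite mxE liftK.
transitivity (\det M); last first.
  apply: (determinant_alternate (i1 := 0) (i2 := lift 0 i)) => // s.
  by rewrite M0 MS.
rewrite (expand_det_row _ 0); apply: eq_bigr => s _.
rewrite M0 [X in _ * X]mxE /circuit_coef /cofactor add0n.
by congr (_ * (_ * \det _)); apply/matrixP => r t; rewrite !mxE liftK.
Qed.

Definition extend0 (T : pzRingType) m (j : 'I_m.+1) (w : 'cV[T]_m) :
    'cV[T]_m.+1 :=
  \col_i oapp (fun k => w k 0) 0 (unlift j i).

Lemma extend0E (T : pzRingType) m j (w : 'cV[T]_m) : extend0 j w j 0 = 0.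
Proof. by rewrite mxE unlift_none. Qed.

Lemma extend0_lift (T : pzRingType) m j (w : 'cV[T]_m) k :
  extend0 j w (lift j k) 0 = w k 0.
Proof. by rewrite mxE liftK. Qed.

Lemma mulmx_extend0 (T : pzRingType) p m (M : 'M[T]_(p, m.+1)) j w :
  M *m extend0 j w = col' j M *m w.
Proof.
apply/matrixP => i k; rewrite !mxE ord1 (bigD1_ord j)//= extend0E mulr0 add0r.
by apply: eq_bigr => l _; rewrite extend0_lift mxE.
Qed.

Lemma extend0_row' (T : pzRingType) m j (y : 'cV[T]_m.+1) :
  y j 0 = 0 -> y = extend0 j (row' j y).
Proof.
move=> yj; apply/matrixP => i k; rewrite ord1.
by case: (unliftP j i) => [l|] ->; rewrite ?extend0_lift ?extend0E ?mxE.
Qed.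

(** A vanishing minor gives an affine dependence that omits the point a_j. *)
Lemma circuit_coef_neq0 (R : realType) n (a : 'I_n.+2 -> 'cV[int]_n) j :
  is_circuit R a -> circuit_coef a j != 0.
Proof.
case=> _ _ [_ min_dep]; rewrite mulf_eq0 signr_eq0 /=.
apply/negP => /eqP det0; apply: (min_dep (~: [set j])%SET).
  by rewrite properEcard finset.subsetT /= cardsC1 cardsT card_ord.
have : \det (col' j (affine_mx (real_pts R a)))^T == 0.
  by rewrite det_tr -map_affine_mx -map_col' det_map_mx det0.
case/det0P => v v_neq0 vM.
have ker_y : affine_mx (real_pts R a) *m extend0 j v^T = 0.
  by rewrite mulmx_extend0 -[X in X *m _]trmxK -trmx_mul vM trmx0.
pose w i := extend0 j v^T i 0.
have sumC (V : nmodType) (F : 'I_n.+2 -> V) : F j = 0 ->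
    \sum_(i in ~: [set j]%SET) F i = \sum_i F i.
  move=> Fj; rewrite [RHS](bigD1 j)//= Fj add0r.
  by apply: eq_bigl => i; rewrite !inE.
move: ker_y.
rewrite affine_mx_mul -[X in _ = X](@col_mx0 _ 1) => /eq_col_mx[w0 wp].
exists w; split.
- have /rV0Pn[k vk] := v_neq0.
  exists (lift j k); first by rewrite !inE eq_sym neq_lift.
  by rewrite /w extend0_lift mxE.
- rewrite sumC; last exact: extend0E.
  by have /matrixP/(_ 0 0) := w0; rewrite !mxE eqxx mulr1n.
- by rewrite sumC // /w extend0E scale0r.
Qed.

(** The open simplices with vertices A minus a_j, for b_j > 0, are disjoint: the
    difference y of two weight vectors of the same point is a multiple of b, but
    y has a negative j-th and a positive j'-th entry, while b_j and b_j' are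
    both positive. *)
Lemma circuit_cells_disjoint (R : realType) n (a : 'I_n.+2 -> 'cV[int]_n)
    (j j' : 'I_n.+2) (w w' : 'cV[R]_n.+1) :
  0 < circuit_coef a j -> 0 < circuit_coef a j' ->
  (forall i, 0 < w i 0) -> (forall i, 0 < w' i 0) ->
  col' j (affine_mx (real_pts R a)) *m w =
    col' j' (affine_mx (real_pts R a)) *m w' ->
  j = j'.
Proof.
set H := affine_mx _; set b := circuit_coef a => bj bj' w0 w'0 ww'.
apply/eqP; apply: contraT => neq_jj'.
pose y := extend0 j w - extend0 j' w'.
pose bR : 'cV[R]_n.+2 := \col_i (b i)%:~R.
have Hy : H *m y = 0 by rewrite mulmxBr !mulmx_extend0 ww' subrr.
have Hb : H *m bR = 0.
  have -> : bR = map_mx intr (\col_j b j) by apply/matrixP => r s; rewrite !mxE.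
  by rewrite /H -map_affine_mx -map_mxM circuit_coef_kernel map_mx0.
(* z is in the kernel and vanishes at j, where the other columns are free. *)
pose z := bR j 0 *: y - y j 0 *: bR.
have z0 : z = 0.
  have zj : z j 0 = 0 by rewrite !mxE mulrC subrr.
  rewrite (extend0_row' zj).
  have -> : row' j z = 0.
    have Hu : col' j H \in unitmx.
      rewrite unitmxE unitfE /H -map_affine_mx -map_col' det_map_mx intr_eq0.
      move: bj; apply: contraTneq => dj.
      by rewrite /b /circuit_coef dj mulr0 ltxx.
    rewrite -[LHS](mulKmx Hu) -mulmx_extend0 -extend0_row'//.
    by rewrite mulmxBr -!scalemxAr Hy Hb !scaler0 subrr mulmx0.
  by apply/matrixP => r s; rewrite !mxE; case: unlift => //= k; rewrite mxE.
have [k' jk'] : exists k', j = lift j' k'.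
  by case: (unliftP j' j) neq_jj' => [k'|] ->; [exists k'|rewrite eqxx].
have [k jk] : exists k, j' = lift j k.
  by case: (unliftP j j') neq_jj' => [k|] ->; [exists k|rewrite eqxx].
have /matrixP/(_ j' 0) := z0.
have yj : y j 0 = - w' k' 0.
  by rewrite mxE extend0E add0r mxE jk' extend0_lift.
have yj' : y j' 0 = w k 0.
  by rewrite mxE [X in _ + X]mxE extend0E subr0 jk extend0_lift.
rewrite [LHS]mxE [X in X + _]mxE [X in _ + X]mxE [X in - X]mxE yj yj' !mxE.
by rewrite mulNr opprK => /eqP; rewrite gt_eqF// addr_gt0// mulr_gt0// ltr0z.
Qed.

Lemma col'_affine_mx (T : pzRingType) n m (p : 'I_m.+1 -> 'cV[T]_n) j :
  col' j (affine_mx p) = affine_mx (p \o lift j).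
Proof.
by apply/matrixP => i k; rewrite !mxE; case: fintype.split => l; rewrite !mxE.
Qed.

Lemma affine_conv_hull (R : realType) n m (p : 'I_m -> 'cV[R]_n) t x
    (w : 'cV[R]_m) :
  0 < t -> (forall i, 0 <= w i 0) -> affine_mx p *m w = col_mx t%:M x ->
  conv_hull p (t^-1 *: x).
Proof.
move=> t0 w0; rewrite affine_mx_mul => /eq_col_mx[/matrixP/(_ 0 0) + <-].
rewrite !mxE eqxx !mulr1n => sum_w; exists (fun i => t^-1 * w i 0); split.
- by move=> i; rewrite mulr_ge0 // invr_ge0 ltW.
- by rewrite -mulr_sumr sum_w mulVf // gt_eqF.
- by rewrite scaler_sumr; apply: eq_bigr => i _; rewrite scalerA.
Qed.

(** The normalized volume of the convex hull of a circuit. *)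
Definition pos_coef_sum n (a : 'I_n.+2 -> 'cV[int]_n) : nat :=
  \sum_(j | (0 < circuit_coef a j)%R) `|circuit_coef a j|%N.

(** The cubes of the various simplices have distinct corners because a corner
    lies in the interior of its dilated simplex. *)
Lemma circuit_lattice_points (R : realType) n (a : 'I_n.+2 -> 'cV[int]_n) :
  is_circuit R a ->
  exists c, forall t, (c <= t)%N -> (0 < t)%N -> exists s : seq 'cV[int]_n,
  [/\ uniq s, (pos_coef_sum a * (t - c) ^ n <= n`! * size s)%N &
    forall p, p \in s -> forall e : 'cV[R]_n, (forall i, 0 <= e i 0 <= 1) ->
      conv_hull (real_pts R a) (t%:R^-1 *: (map_mx intr p + e))].
Proof.
move=> circ; pose q j := a \o lift j.
have cofE j : `|(\det (affine_mx (q j)))%R|%N = `|circuit_coef a j|%N.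
  by rewrite /circuit_coef abszM abszX abszN1 exp1n mul1n -col'_affine_mx.
have det_neq0 j : \det (affine_mx (q j)) != 0.
  by rewrite -absz_eq0 cofE absz_eq0 (circuit_coef_neq0 _ circ).
have /fin_all_exists[c cP] j := @simplex_lattice_points R n (q j) (det_neq0 j).
exists (\sum_j c j)%N => t ct t0.
have c_le j : (c j <= \sum_j c j)%N by rewrite (bigD1 j)//= leq_addr.
have /fin_all_exists[S SP] j := cP j t (leq_trans (c_le j) ct).
pose J := [seq j <- enum 'I_n.+2 | 0 < circuit_coef a j].
exists [seq p | j <- J, p <- S j]; split.
- apply: allpairs_uniq_dep => [|j _|].
  + by rewrite filter_uniq // enum_uniq.
  + by have [] := SP j.
  move=> z z' /allpairsPdep[j [p [jJ pS ->{z}]]].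
  move=> /allpairsPdep[j' [p' [j'J p'S ->{z'}]]].
  move=> /= pp'; rewrite -{p'}pp' in p'S *.
  suff -> : j = j' by [].
  have [_ _ /(_ p pS 0)] := SP j; have [_ _ /(_ p p'S 0)] := SP j'.
  have e01 (i : 'I_n) : 0 <= (0 : 'cV[R]_n) i 0 <= 1 by rewrite mxE lexx ler01.
  move=> /(_ e01)[w' w'0 Hw'] /(_ e01)[w w0 Hw].
  apply: (@circuit_cells_disjoint R n a j j' w w') => //.
  + by move: jJ; rewrite mem_filter => /andP[].
  + by move: j'J; rewrite mem_filter => /andP[].
  by rewrite !col'_affine_mx; exact: etrans Hw (esym Hw').
- rewrite size_allpairs_dep sumnE big_map big_filter big_enum_cond /=.
  rewrite /pos_coef_sum big_distrl big_distrr /=; apply: leq_sum => j _.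
  have [_ + _] := SP j; rewrite cofE; apply: leq_trans.
  have mono x y : (x <= y -> x ^ n <= y ^ n)%N.
    by case: (posnP n) => [->|n0]; rewrite ?expn0 ?leq_exp2r.
  by rewrite leq_mul2l mono ?orbT // leq_sub2l.
- move=> _ /allpairsPdep[j [p [_ pS ->]]] e e01.
  have [_ _ /(_ p pS e e01)[w w0 Hw]] := SP j.
  apply: (@affine_conv_hull _ _ _ _ _ _ (extend0 j w)); rewrite ?ltr0n //.
    move=> i; case: (unliftP j i) => [k|] ->; last by rewrite extend0E.
    by rewrite extend0_lift ltW.
  by rewrite mulmx_extend0 col'_affine_mx.
Qed.

Lemma bernoulli_sub (R : realType) (x : R) n :
  0 <= x <= 1 -> 1 - n%:R * x <= (1 - x) ^+ n.
Proof.
case/andP=> x0 x1; elim: n => [|n IH]; first by rewrite mul0r subr0 expr0.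
rewrite exprS; apply: le_trans (ler_wpM2l _ IH); last by rewrite subr_ge0.
have : 0 <= n%:R * x * x by rewrite !mulr_ge0.
rewrite -natr1; lra.
Qed.

(** The cube count gives V (1 - c/t)^n <= n! vol for every large t. *)
Lemma le_vol_Z (R : realType) n (a : 'I_n.+2 -> 'cV[int]_n) :
  is_circuit R a -> (((pos_coef_sum a)%:R)%:E <= vol_Z R a)%E.
Proof.
move=> /circuit_lattice_points[c cP]; rewrite /vol_Z.
set V := pos_coef_sum a; set X := conv_hull _.
have := lebesgue_cV_ge0 X; case lX : (lebesgue_cV X) => [y| |] // y0.
  rewrite -EFinM lee_fin; rewrite lee_fin in y0.
  apply/ler_addgt0Pr => eps eps0.
  (* For t > K the error term V n c / t of the Bernoulli bound is below eps. *)
  pose K : R := V%:R * (n%:R * c%:R) / eps.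
  pose t := (c + (Num.truncn K).+1)%N.
  have t0 : (0 < t)%N by rewrite /t addnS.
  have ct : (c <= t)%N by exact: leq_addr.
  have [s [s_uniq s_size sX]] := cP t ct t0.
  have tR0 : 0 < t%:R :> R by rewrite ltr0n.
  have := @lebesgue_cV_cubes R n X t%:R^-1 s.
  rewrite invr_gt0 tR0 => /(_ isT s_uniq) H.
  have {H} : (size s)%:R * t%:R^-1 ^+ n <= y.
    rewrite -lee_fin -lX; apply: H => p ps e e01; apply: sX => // i.
    by have /andP[-> /ltW ->] := e01 i.
  rewrite -(ler_pM2l (_ : 0 < n`!%:R)) ?ltr0n ?fact_gt0 // mulrA -natrM => sy.
  have {sy} : V%:R * (1 - c%:R / t%:R) ^+ n <= n`!%:R * y.
    apply: le_trans sy; rewrite -[X in X - _](divff (lt0r_neq0 tR0)) -mulrBl.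
    rewrite exprMn mulrA ler_wpM2r ?exprn_ge0 ?invr_ge0 //.
    by rewrite -natrB // -natrX -natrM ler_nat.
  rewrite -lerBlDr; apply: le_trans.
  have xt : 0 <= (c%:R / t%:R : R) <= 1.
    by rewrite divr_ge0 ?ler0n //= ler_pdivrMr // mul1r ler_nat.
  apply: le_trans (ler_wpM2l _ (bernoulli_sub n xt)); last exact: ler0n.
  rewrite mulrBr mulr1 lerB //.
  have -> : V%:R * (n%:R * (c%:R / t%:R)) = K * eps / t%:R.
    by rewrite /K divfK ?gt_eqF // !mulrA.
  rewrite ler_pdivrMr // mulrC ler_wpM2l ?(ltW eps0) //.
  by apply: le_trans (ltW (truncnS_gt K)) _; rewrite ler_nat leq_addl.
by rewrite gt0_muley ?leey // lte_fin ltr0n fact_gt0.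
Qed.

(** * Sign variations of sums over a chain *)

Lemma sum_absz_subset m (b : 'I_m -> int) (A B : {set 'I_m}) :
  A \subset B ->
  (\sum_(j in A) `|b j| + `|(\sum_(j in B) b j - \sum_(j in A) b j)%R|
     <= \sum_(j in B) `|b j|)%N.
Proof.
move=> sAB; have le_abs (C : {set 'I_m}) :
    (`|(\sum_(j in C) b j)%R| <= \sum_(j in C) `|b j|)%N.
  apply: (big_rec2 (fun (y : int) x => `|y| <= x)%N) => // j x y _; lia.
have split_sum (T : nmodType) (F : 'I_m -> T) :
    (\sum_(j in B) F j = \sum_(j in A) F j + \sum_(j in B :\: A) F j)%R.
  by rewrite (big_setID A) /= (finset.setIidPr sAB).
by rewrite (split_sum _ b) (split_sum nat) addrC addKr leq_add2l.
Qed.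

(** The set counted by [sgnvar c]. *)
Definition sign_changes k (c : 'I_k -> int) : {set 'I_k * 'I_k} :=
  [set p : 'I_k * 'I_k | [&& (p.1 < p.2)%N, c p.1 * c p.2 < 0 &
      [forall l : 'I_k, (p.1 < l < p.2)%N ==> (c l == 0)]]]%SET.

Definition sign_changes_until k (c : 'I_k -> int) (l : 'I_k) :
    {set 'I_k * 'I_k} :=
  [set p in sign_changes c | (p.2 <= l)%N]%SET.

Lemma sign_change_neq0 k (c : 'I_k -> int) p :
  p \in sign_changes c -> c p.1 != 0 /\ c p.2 != 0.
Proof.
rewrite inE => /and3P[_ + _] => opp.
by split; apply: contraTneq opp => ->; rewrite ?mul0r ?mulr0 ltxx.
Qed.

(** Since c vanishes strictly between l' and l, another change ending by l
    cannot end after l' without ending at l, and then it starts at l' too. *)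
Lemma card_sign_changes_until k (c : 'I_k -> int) (l' l : 'I_k) :
  (l', l) \in sign_changes c ->
  (#|sign_changes_until c l| <= #|sign_changes_until c l'|.+1)%N.
Proof.
move=> Zl; have [/= c1' c2'] := sign_change_neq0 Zl.
move: Zl; rewrite inE /= => /and3P[lt_l'l _ /forallP between].
rewrite -add1n -(cards1 (l', l)); apply: leq_trans (leq_card_setU _ _).
apply/subset_leq_card/fintype.subsetP => -[p1 p2].
rewrite finset.in_set /= => /andP[Zp le_p2]; rewrite !finset.in_setU.
rewrite [X in _ || X]finset.in_set Zp /= finset.in_set1 xpair_eqE.
case: (leqP p2 l') => [|lt_l'p2]; first by rewrite orbT.
have [/= c1 c2] := sign_change_neq0 Zp.
move: Zp; rewrite inE /= => /and3P[lt_p _ /forallP betw].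
have p2l : p2 = l.
  apply/val_inj/eqP; rewrite eqn_leq le_p2 leqNgt; apply/negP => lt_p2.
  by have := between p2; rewrite lt_l'p2 lt_p2 (negPf c2).
rewrite p2l eqxx andbT orbF; apply/eqP/val_inj/eqP.
rewrite p2l in betw lt_p *.
case: ltngtP => // lt_; [have := betw l' | have := between p1].
  by rewrite lt_ lt_l'l (negPf c1').
by rewrite lt_ lt_p (negPf c1).
Qed.

(** Induction along the chain. If a sign variation (l', l) ends at l, then c
    moves by |c_l'| + |c_l|, and |c_l'| >= g pays for it together with the
    |c_l'| kept in the bound at l'. Otherwise the triangle inequality with the
    preceding index suffices. *)
Lemma chain_variation_bound k m g (S : 'I_k -> {set 'I_m}) (b : 'I_m -> int)
    (c := fun l => \sum_(j in S l) b j) :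
  (forall l l' : 'I_k, (l <= l')%N -> S l \subset S l') ->
  (forall l, c l != 0 -> (g <= `|c l|)%N) ->
  forall l, (2 * g * #|sign_changes_until c l| + `|c l|
    <= \sum_(j in S l) `|b j|)%N.
Proof.
move=> S_mono c_ge; pose cnt l := #|sign_changes_until c l|.
case=> l; elim/ltn_ind: l => l IH lk; set L := Ordinal lk.
have [/existsP[l' Zl']|/existsPn noZ] :=
    boolP [exists l', (l', L) \in sign_changes c].
  have cnt_l' : (cnt L <= (cnt l').+1)%N by exact: card_sign_changes_until.
  have [/= cl' _] := sign_change_neq0 Zl'.
  have := Zl'; rewrite inE /= => /and3P[lt_l'l opp _].
  have := IH l' lt_l'l (ltn_ord l').
  rewrite (_ : Ordinal _ = l'); last exact/val_inj.
  have := sum_absz_subset b (S_mono l' L (ltnW lt_l'l)).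
  rewrite -/(c l') -/(c L) -/(cnt l') -/(cnt L).
  have := c_ge _ cl'.
  have -> : `|(c L - c l')%R|%N = (`|c L| + `|c l'|)%N.
    by move: opp; rewrite -/L; case: (c L) (c l') => x [] y; lia.
  have : (2 * g * cnt L <= 2 * g * cnt l' + 2 * g)%N.
    by rewrite addnC -mulnS leq_mul2l cnt_l' orbT.
  move: (cnt L) (cnt l') (absz (c L)) (absz (c l')) => nL nl' cL cl''.
  move: (\sum_(j in S l') _)%N (\sum_(j in S L) _)%N => *; lia.
have neqL p : p \in sign_changes c -> p.2 != L.
  by case: p => p1 p2 pZ; apply/eqP => /= p2L; have := noZ p1; rewrite -p2L pZ.
case: l => [|l] in IH lk L noZ neqL *.
  have -> : #|sign_changes_until c L| = 0%N.
    apply/eqP; rewrite cards_eq0; apply/eqP/finset.setP => p.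
    rewrite finset.in_set [RHS]inE.
    by apply/negP => /andP[]; rewrite inE => /andP[+ _]; rewrite /L /=; lia.
  have := sum_absz_subset b (finset.sub0set (S L)).
  by rewrite !big_set0 subr0 muln0.
have lk' : (l < k)%N by exact: ltnW.
have := IH l (ltnSn l) lk'; set L' := Ordinal lk'.
have : (cnt L <= cnt L')%N.
  apply/subset_leq_card/fintype.subsetP => p.
  rewrite [p \in sign_changes_until c L]finset.in_set => /andP[pZ].
  rewrite [p \in sign_changes_until c L']finset.in_set pZ.
  rewrite leq_eqVlt => /orP[/eqP e|//].
  by have /eqP[] := neqL p pZ; apply/val_inj.
have := sum_absz_subset b (S_mono L' L (leqnSn l)); rewrite -/(c L') -/(c L).
rewrite -/(cnt L') -/(cnt L); nia.
Qed.

(** [chain_variation_bound] at the end of the last sign variation leaves a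
    nonzero sum c_l, and |c_l| is spent once more on the way back to 0. Without
    any sign variation, a nonzero b_j and the sum of the others do. *)
Lemma sgnvar_chain_bound k m (g : nat) (S : 'I_k -> {set 'I_m})
    (b : 'I_m -> int)
    (c := fun l => \sum_(j in S l) b j) :
  (forall l l' : 'I_k, (l <= l')%N -> S l \subset S l') ->
  (forall j, (g %| b j)%Z) ->
  \sum_j b j = 0 -> (exists j, b j != 0) ->
  (2 * g * (1 + sgnvar c) <= \sum_j `|b j|)%N.
Proof.
move=> S_mono b_dvd sum_b0 [j0 bj0].
have g_le x : (g %| x)%Z -> x != 0 -> (g <= `|x|)%N.
  by move=> gx x0; apply: dvdn_leq; rewrite ?absz_gt0.
have c_ge l : c l != 0 -> (g <= `|c l|)%N.
  by apply: g_le; apply: rpred_sum => j _; apply: b_dvd.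
have total (A : {set 'I_m}) :
    (\sum_(j in A) `|b j| + `|(\sum_(j in A) b j)%R| <= \sum_j `|b j|)%N.
  have := sum_absz_subset b (finset.subsetT A).
  by rewrite !(eq_bigl _ _ (@finset.in_setT _)) sum_b0 sub0r abszN.
have -> : sgnvar c = #|sign_changes c| by [].
have [->|[p pZ]] := finset.set_0Vmem (sign_changes c).
  rewrite cards0; have := total [set j0]%SET; rewrite !big_set1.
  have := g_le _ (b_dvd j0) bj0; lia.
case: (@arg_maxnP _ p (mem (sign_changes c)) (fun p => p.2 : nat) pZ).
move=> q qZ qmax; have [_ cq] := sign_change_neq0 qZ.
have := total (S q.2); have := chain_variation_bound S_mono c_ge q.2.
have := c_ge _ cq.
have -> : #|sign_changes_until c q.2| = #|sign_changes c|.
  by apply: eq_card => p'; rewrite finset.in_set andb_idr // => /qmax.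
rewrite -/(c q.2); nia.
Qed.

Lemma sum_absz_pos m (b : 'I_m -> int) :
  \sum_j b j = 0 ->
  (\sum_j `|b j| = 2 * \sum_(j | (0 < b j)%R) `|b j|)%N.
Proof.
move=> sum_b0.
have : (\sum_(j | (0 < b j)%R) `|b j| = \sum_(j | ~~ (0 < b j)%R) `|b j|)%N.
  apply/eqP; rewrite -eqz_nat !(big_morph Posz PoszD erefl) -subr_eq0.
  have := sum_b0; rewrite (bigID (fun j => 0 < b j)) /= => sum_b.
  rewrite -[eqbRHS]sum_b -sumrN; apply/eqP; congr (_ + _); apply: eq_bigr => j.
    exact: gtz0_abs.
  by rewrite -leNgt => /lez0_abs ->; rewrite opprK.
move=> posneg; rewrite (bigID (fun j => 0 < b j)%R) /=.
by rewrite -posneg mul2n addnn.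
Qed.

(** * The bound *)

Theorem lemma2p13 (R : realType) (n : nat) (a : 'I_n.+2 -> 'cV[int]_n)
    (C : 'M[R]_(n, n.+2)) (P : 'M[R]_(n.+2, 2)) (sigma : 'S_n.+2)
    (K : {set 'I_n.+2}) (sbar : 'I_#|gale_classes P| -> 'I_n.+2) :
  is_circuit R a ->
  \rank C = n ->
  zero_in_pos_span C ->
  is_gale_dual C P ->
  is_ordering P sigma ->
  finset.is_transversal K (gale_classes P) [set: 'I_n.+2]%SET ->
  induced_strict_ordering sigma K sbar ->
  (((1 + sgnvar (mu a P sbar))%N%:R)%:E <= vol_ZA R a)%E.
Proof.
move=> circ _ _ _ _ _ _; pose b := circuit_coef a.
have b_neq0 j : b j != 0 by exact: circuit_coef_neq0 circ.
have minorE j : \det (affine_mx a *m colsub (lift j) 1%:M) = (-1) ^+ j * b j.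
  by rewrite -col'_colsub mulrA -expr2 sqrr_sign mul1r.
have [|g_gt0 g_dvd] := @lattice_index_dvd n n.+1 a (colsub (lift 0) 1%:M).
  by rewrite minorE mulf_neq0 ?signr_eq0.
set g := lattice_index _ in g_gt0 g_dvd.
have b_dvd j : (g %| b j)%Z.
  by have := g_dvd (colsub (lift j) 1%:M); rewrite minorE !dvdzE abszMsign.
have sum_b : \sum_j b j = 0.
  have := circuit_coef_kernel a.
  rewrite affine_mx_mul -[X in _ = X](@col_mx0 _ 1).
  move=> /eq_col_mx[/matrixP/(_ 0 0)].
  by rewrite !mxE eqxx mulr1n; under eq_bigr do rewrite mxE.
have S_mono (l l' : 'I_#|gale_classes P|) : (l <= l')%N ->
    initial_classes P sbar l \subset initial_classes P sbar l'.
  move=> ll'; apply/bigcupsP => i il.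
  by apply: (finset.bigcup_sup i); apply: leq_trans ll'.
have key : ((1 + sgnvar (mu a P sbar)) * g <= pos_coef_sum a)%N.
  have := sgnvar_chain_bound S_mono b_dvd sum_b (ex_intro _ 0 (b_neq0 0)).
  by rewrite sum_absz_pos // -mulnA leq_pmul2l // mulnC.
rewrite /vol_ZA -/g.
apply: le_trans (lee_wpmul2r _ (le_vol_Z circ)); last first.
  by rewrite lee_fin invr_ge0.
by rewrite -EFinM lee_fin ler_pdivlMr ?ltr0n // -natrM ler_nat.
Qed.
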